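(* Let $F$ be an exponential field whose kernel $\operatorname{Ker}=\{x\in F : \mathrm{E}(x)=1\}$ is an infinite cyclic group. Then every real abelian algebraic number is pointwise definable in $F$: for every $\alpha\in\mathbb{Q}^{\mathrm{rab}}\subseteq F$ there is a first-order formula $\varphi(x)$ without parameters, in the language $\{+,\cdot,-,0,1,\mathrm{E}\}$, such that $\alpha$ is the unique element of $F$ satisfying $\varphi$.
   Context: An exponential field (E-field) is a field $F$ of characteristic $0$ together with a map $\mathrm{E}:F\to F$ satisfying $\mathrm{E}(0)=1$ and $\mathrm{E}(x+y)=\mathrm{E}(x)\mathrm{E}(y)$. If $\operatorname{Ker}$ is infinite cyclic with generator $\tau$, then the elements $\mathrm{E}(j\tau/n)$, $j=0,\dots,n-1$, are the distinct $n$-th roots of unity, so $F$ contains the group $U$ of all roots of unity and hence the maximal abelian extension $\mathbb{Q}^{\mathrm{ab}}=\mathbb{Q}(U)$ of $\mathbb{Q}$. Let $\sigma_0$ be the field automorphism of $\mathbb{Q}^{\mathrm{ab}}$ determined by $\sigma_0(x)=x^{-1}$ for all $x\in U$. The field of real abelian numbers is $\mathbb{Q}^{\mathrm{rab}}=\{x\in\mathbb{Q}^{\mathrm{ab}}:\sigma_0(x)=x\}$. *)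

(* Defs.v *)
From mathcomp Require Import all_boot all_order all_algebra.

Set Implicit Arguments.
Unset Strict Implicit.
Unset Printing Implicit Defensive.

Import GRing.Theory.
Local Open Scope ring_scope.

Record exponential_field (F : fieldType) (E : F -> F) : Prop := {
  expfield_pchar0 : [pchar F] =i pred0;
  expfield_E0 : E 0 = 1;
  expfield_ED : forall x y, E (x + y) = E x * E y }.

Definition exp_kernel (F : fieldType) (E : F -> F) : F -> Prop :=
  fun x => E x = 1.

Definition infinite_cyclic (V : zmodType) (A : V -> Prop) : Prop :=
  exists t : V, injective (fun m : int => t *~ m) /\
                forall x, A x <-> exists m : int, x = t *~ m.

Definition is_root_of_unity (F : fieldType) : F -> Prop :=
  fun u => exists2 n, (0 < n)%N & n.-unity_root u.

(* The closure clauses need no nonzero condition on inverses: 0^-1 = 0. *)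
Inductive subfield_generated (F : fieldType) (S : F -> Prop) : F -> Prop :=
| Subfield_gen x : S x -> subfield_generated S x
| Subfield_one : subfield_generated S 1
| Subfield_sub x y : subfield_generated S x -> subfield_generated S y ->
    subfield_generated S (x - y)
| Subfield_mul x y : subfield_generated S x -> subfield_generated S y ->
    subfield_generated S (x * y)
| Subfield_inv x : subfield_generated S x -> subfield_generated S x^-1.

(* In characteristic 0 the prime field is Q, so this is Q(U). *)
Definition Qab (F : fieldType) : F -> Prop :=
  subfield_generated (@is_root_of_unity F).

(* Only the values of s on K matter; injectivity is automatic. *)
Record field_automorphism_on (F : fieldType) (K : F -> Prop) (s : F -> F) :
    Prop := {
  autom_stable : forall x, K x -> K (s x);
  autom_onto : forall y, K y -> exists2 x, K x & s x = y;
  autom_one : s 1 = 1;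
  autom_add : forall x y, K x -> K y -> s (x + y) = s x + s y;
  autom_mul : forall x y, K x -> K y -> s (x * y) = s x * s y }.

Definition is_sigma0 (F : fieldType) (s : F -> F) : Prop :=
  field_automorphism_on (@Qab F) s /\
  forall u, is_root_of_unity u -> s u = u^-1.

(* For the fields under consideration sigma0 exists and is unique on Qab.  The
   universal quantifier refers to it without making its existence a
   hypothesis: were there no such s, Qrab would be all of Qab. *)
Definition Qrab (F : fieldType) : F -> Prop :=
  fun x => Qab x /\ forall s : F -> F, is_sigma0 s -> s x = x.

(* First-order language {+, *, -, 0, 1, E}, with - unary.  Syntax is well
   scoped: terms and formulas are indexed by the number n of free variables
   allowed, and quantifiers bind the variable of index 0 (de Bruijn). *)
Inductive eterm (n : nat) : Type :=
| EVar of 'I_n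
| EZero
| EOne
| EOpp of eterm n
| EAdd of eterm n & eterm n
| EMul of eterm n & eterm n
| EExp of eterm n.

Inductive eformula : nat -> Type :=
| FEq n of eterm n & eterm n : eformula n
| FNot n of eformula n : eformula n
| FAnd n of eformula n & eformula n : eformula n
| FOr n of eformula n & eformula n : eformula n
| FImp n of eformula n & eformula n : eformula n
| FForall n of eformula n.+1 : eformula n
| FExists n of eformula n.+1 : eformula n.

Fixpoint eval_eterm (F : fieldType) (E : F -> F) n (e : 'I_n -> F)
    (t : eterm n) : F :=
  match t with
  | EVar i => e i
  | EZero => 0
  | EOne => 1
  | EOpp t1 => - eval_eterm E e t1
  | EAdd t1 t2 => eval_eterm E e t1 + eval_eterm E e t2
  | EMul t1 t2 => eval_eterm E e t1 * eval_eterm E e t2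
  | EExp t1 => E (eval_eterm E e t1)
  end.

Definition env_cons (T : Type) n (x : T) (e : 'I_n -> T) : 'I_n.+1 -> T :=
  fun i => if unlift ord0 i is Some j then e j else x.

Fixpoint esat (F : fieldType) (E : F -> F) n (f : eformula n) :
    ('I_n -> F) -> Prop :=
  match f in eformula m return ('I_m -> F) -> Prop with
  | FEq _ t1 t2 => fun e => eval_eterm E e t1 = eval_eterm E e t2
  | FNot _ f1 => fun e => ~ esat E f1 e
  | FAnd _ f1 f2 => fun e => esat E f1 e /\ esat E f2 e
  | FOr _ f1 f2 => fun e => esat E f1 e \/ esat E f2 e
  | FImp _ f1 f2 => fun e => esat E f1 e -> esat E f2 e
  | FForall _ f1 => fun e => forall x : F, esat E f1 (env_cons x e)
  | FExists _ f1 => fun e => exists x : F, esat E f1 (env_cons x e)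
  end.

Definition pointwise_definable (F : fieldType) (E : F -> F) (a : F) : Prop :=
  exists phi : eformula 1, forall x : F, esat E phi (fun=> x) <-> x = a.

(* Main.v *)
Require Import Defs.
From HB Require Import structures.
From mathcomp Require Import all_boot all_order all_algebra algC.
From Stdlib Require Import ClassicalEpsilon.

(* Let tau generate the kernel and zeta_n = E (tau / n), a primitive n-th root
   of unity.  An element m of F with m * Ker contained in Ker is an integer, so
   the set {tau, - tau} of generators of the kernel is definable, although tau
   itself is not.  An element alpha of Qab is p(zeta_n) for some p in Q[X], and
   it is fixed by sigma0 iff p(zeta_n) = p(zeta_n^-1), i.e. iff p(E (t / n)) is
   the same for both generators t; then "alpha = p(E (t / n)) for some
   generator t of the kernel" defines alpha.

   That sigma0 exists means that a rational polynomial vanishing at an n-th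
   root of unity z of F vanishes at z^-1.  This is transferred from algC, where
   z^-1 is the complex conjugate of z. *)

Set Implicit Arguments.
Unset Strict Implicit.
Unset Printing Implicit Defensive.

Import GRing.Theory Num.Theory.
Local Open Scope ring_scope.

(** * The embedding of the rationals in a field of characteristic 0 *)

Section CharZero.

Variable F : fieldType.
Hypothesis pcharF0 : [pchar F] =i pred0.

Lemma pchar0_intr_eq0 (m : int) : (m%:~R == 0 :> F) = (m == 0).
Proof.
case: m => n; first by rewrite -pmulrn (pcharf0P F).1.
by rewrite NegzE mulrNz !oppr_eq0 -pmulrn (pcharf0P F).1.
Qed.

Lemma pchar0_ratr_frac (a b : int) : b != 0 ->
  ratr (a%:~R / b%:~R) = a%:~R / b%:~R :> F.
Proof.
move=> nz_b; set x : rat := _ / _.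
have nz_bQ : b%:~R != 0 :> rat by rewrite intr_eq0.
have /eqP/= Dx : numq x * b == a * denq x.
  rewrite -(eqr_int rat) !intrM numqE.
  by rewrite mulrAC {1}/x divfK.
apply/eqP; rewrite /ratr eqr_div ?pchar0_intr_eq0 ?denq_eq0 //.
by rewrite -!intrM Dx.
Qed.

(** [ratr] reads off reduced fractions, so sums and products are computed on unreduced ones and
    compared through [pchar0_ratr_frac]; denominators stay nonzero in characteristic 0. *)
Lemma pchar0_rmorph_rat : exists f : {rmorphism rat -> F}, True.
Proof.
have nz_den (x : rat) : denq x != 0 by rewrite denq_eq0.
have nz_denF (x : rat) : (denq x)%:~R != 0 :> F by rewrite pchar0_intr_eq0.
have nz_denQ (x : rat) : (denq x)%:~R != 0 :> rat by rewrite intr_eq0.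
have ratrB : zmod_morphism (@ratr F).
  move=> x y; rewrite -{1}[x]divq_num_den -{1}[y]divq_num_den -mulNr addf_div //.
  rewrite -mulrNz -!intrM -intrD pchar0_ratr_frac ?mulf_neq0 //.
  by rewrite intrD !intrM mulrNz -addf_div // mulNr.
have ratrM : monoid_morphism (@ratr F).
  split=> [|x y]; first by rewrite -[1]/(1%:~R) ratr_int.
  rewrite -{1}[x]divq_num_den -{1}[y]divq_num_den mulf_div -!intrM.
  by rewrite pchar0_ratr_frac ?mulf_neq0 // !intrM -mulf_div.
pose fB := GRing.isZmodMorphism.Build rat F (@ratr F) ratrB.
pose fM := GRing.isMonoidMorphism.Build rat F (@ratr F) ratrM.
pose f : {rmorphism rat -> F} := HB.pack (@ratr F) fB fM.
by exists f.
Qed.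

End CharZero.

(** * Rational polynomials at roots of unity *)

Lemma comp_Xn_horner (F : fieldType) (f : {rmorphism rat -> F})
    (p : {poly rat}) n (z : F) :
  (map_poly f (p \Po 'X^n)).[z] = (map_poly f p).[z ^+ n].
Proof. by rewrite map_comp_poly map_polyXn horner_comp hornerXn. Qed.

(** Inversion is thus polynomial on [n]-th roots of unity: composing with ['X^(n.-1)] evaluates a
    polynomial at the inverse. *)
Lemma unity_root_exp_pred (F : fieldType) n (z : F) :
  (0 < n)%N -> z ^+ n = 1 -> z ^+ n.-1 = z^-1.
Proof.
case: n => // n _ zn1; have nz_z : z != 0.
  by apply: contra_eq_neq zn1 => ->; rewrite expr0n eq_sym oner_neq0.
by apply: (mulfI nz_z); rewrite -exprS zn1 mulfV.
Qed.

Lemma unity_root_conj n (w : algC) : (0 < n)%N -> w ^+ n = 1 -> w ^+ n.-1 = w^*.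
Proof.
move=> n_gt0 wn1; rewrite unity_root_exp_pred // invC_norm.
suff -> : `|w| = 1 by rewrite expr1n invr1 mul1r.
by apply/eqP; rewrite -(pexpr_eq1 n_gt0) // -normrX wn1 normr1.
Qed.

Section RationalPolynomials.

Variables (F : fieldType) (f : {rmorphism rat -> F}).

Local Notation "p ^f" := (map_poly f p) : ring_scope.
Implicit Types (p q : {poly rat}) (z : F).

(* If z were not a root of q, it would be a root of the largest divisor of p
   coprime to q, and the latter would have a root in algC. *)
Lemma algC_root_transfer p q z : p != 0 ->
    (forall w : algC, root (map_poly ratr p) w -> root (map_poly ratr q) w) ->
  root p^f z -> root q^f z.
Proof.
move=> nz_p p_q pz0; apply: contraT => qzn0.
set h := gdcop q p.
have hz0 : root h^f z by rewrite gdcop_map root_gdco ?map_poly_eq0 // pz0.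
have nz_h : h != 0 by apply: dvdpN0 (dvdp_gdco _ _) nz_p.
have h_gt1 : (1 < size h)%N.
  by rewrite -(size_map_poly f); apply: root_size_gt1 hz0; rewrite map_poly_eq0.
have /closed_rootP[w hw0] : size (map_poly (ratr : rat -> algC) h) != 1%N.
  by rewrite size_map_poly neq_ltn h_gt1 orbT.
have pw0 : root (map_poly ratr p) w.
  by apply: root_dvdp hw0; rewrite dvdp_map dvdp_gdco.
have := coprimep_gdco q nz_p; rewrite -(coprimep_map (@ratr algC)).
by move/coprimep_root/(_ hw0); rewrite (eqP (p_q w pw0)) eqxx.
Qed.

(** The gcd with ['X^n - 1] has only roots of unity as roots in [algC]. There inversion is
    conjugation, which fixes rational coefficients and so maps roots of [p] to roots of [p]. *)
Lemma root_unity_root_inv p n z : (0 < n)%N -> z ^+ n = 1 ->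
  root p^f z -> root p^f z^-1.
Proof.
move=> n_gt0 zn1 pz0.
have nz_Xn1 : 'X^n - 1 != 0 :> {poly rat} by rewrite monic_neq0 ?monicXnsubC.
pose d := gcdp p ('X^n - 1).
have dz0 : root d^f z.
  rewrite gcdp_map root_gcd pz0 rmorphB rmorph1 /= map_polyXn.
  by rewrite /root !hornerE zn1 subrr.
have nz_d : d != 0 by rewrite gcdp_eq0 negb_and nz_Xn1 orbT.
suff : root (p \Po 'X^(n.-1))^f z.
  by rewrite /root comp_Xn_horner unity_root_exp_pred.
apply: algC_root_transfer nz_d _ dz0 => w.
rewrite gcdp_map root_gcd rmorphB rmorph1 /= map_polyXn => /andP[/eqP pw0].
rewrite /root !hornerE subr_eq0 comp_Xn_horner => /eqP wn1.
rewrite (unity_root_conj n_gt0 wn1).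
have -> : map_poly ratr p = map_poly Num.conj (map_poly ratr p) :> {poly algC}.
  by rewrite -map_poly_comp; apply: eq_map_poly => a /=; rewrite fmorph_rat.
by rewrite horner_map pw0 rmorph0.
Qed.

Lemma horner_unity_root_inv p q n z : (0 < n)%N -> z ^+ n = 1 ->
  p^f.[z] = q^f.[z] -> p^f.[z^-1] = q^f.[z^-1].
Proof.
move=> n_gt0 zn1 /eqP; rewrite -subr_eq0 => pq0.
apply/eqP; rewrite -subr_eq0 -hornerN -hornerD -rmorphB.
apply: root_unity_root_inv zn1 _ => //.
by rewrite /root rmorphB hornerD hornerN.
Qed.

(** If [p] does not vanish at [z], the part [h] of ['X^n - 1] coprime to [p] still vanishes there,
    and a Bezout relation [u * h + v * p = 1] evaluated at [z] gives the inverse. *)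
Lemma horner_unity_rootV p n z : (0 < n)%N -> z ^+ n = 1 ->
  exists q, (p^f.[z])^-1 = q^f.[z].
Proof.
move=> n_gt0 zn1; have [-> | nz_pz] := eqVneq p^f.[z] 0.
  by exists 0; rewrite invr0 rmorph0 horner0.
have nz_Xn1 : 'X^n - 1 != 0 :> {poly rat} by rewrite monic_neq0 ?monicXnsubC.
have [h /eqP hz0 /Bezout_eq1_coprimepP[[u v] /= Duv]] :
    exists2 h, root h^f z & coprimep h p.
  exists (gdcop p ('X^n - 1)); last exact: coprimep_gdco.
  rewrite gdcop_map root_gdco ?map_poly_eq0 // nz_pz andbT.
  by rewrite rmorphB rmorph1 /= map_polyXn /root !hornerE zn1 subrr.
exists v; apply: (mulIf nz_pz); rewrite mulVf //.
have := congr1 (fun r => r^f.[z]) Duv.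
rewrite /= rmorphD !rmorphM /= hornerD !hornerM hz0 mulr0 add0r => ->.
by rewrite rmorph1 hornerC.
Qed.

End RationalPolynomials.

(** * Construction of sigma0 on [Qab] *)

Section InverseAutomorphism.

Variables (F : fieldType) (f : {rmorphism rat -> F}) (zeta : nat -> F).
Hypothesis zeta_prim : forall n, (0 < n)%N -> n.-primitive_root (zeta n).
Hypothesis zeta_exp : forall n m, (0 < n)%N -> (0 < m)%N ->
  zeta (n * m)%N ^+ m = zeta n.

Local Notation "p ^f" := (map_poly f p) : ring_scope.

Lemma Qab_horner (p : {poly rat}) (z : F) :
  is_root_of_unity z -> Qab p^f.[z].
Proof.
move=> Uz; have Q1 : Qab (1 : F) := Subfield_one _.
have Q0 : Qab (0 : F) by rewrite -(subrr 1); apply: Subfield_sub.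
have QD (x y : F) : Qab x -> Qab y -> Qab (x + y).
  move=> Qx Qy; rewrite -[y]opprK; apply: Subfield_sub => //.
  by rewrite -sub0r; apply: Subfield_sub.
have Qnat n : Qab (n%:R : F).
  by elim: n => // n IHn; rewrite mulrS; apply: QD.
have Qint m : Qab (m%:~R : F).
  case: m => n; first exact: Qnat.
  by rewrite NegzE mulrNz -sub0r; apply: Subfield_sub => //; apply: Qnat.
have Qrat a : Qab (f a).
  by rewrite fmorph_eq_rat; exact: Subfield_mul (Qint _) (Subfield_inv (Qint _)).
elim/poly_ind: p => [|p a IHp]; first by rewrite rmorph0 horner0.
rewrite rmorphD rmorphM /= map_polyX map_polyC hornerD hornerM hornerX hornerC.
exact: QD (Subfield_mul IHp (Subfield_gen Uz)) (Qrat a).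
Qed.

(** The graph of sigma0, given as a relation because [x] determines neither the level [n] nor the
    polynomial [p]. *)
Definition inv_rel (x y : F) : Prop :=
  exists2 n, (0 < n)%N & exists p, x = p^f.[zeta n] /\ y = p^f.[(zeta n)^-1].

Lemma zeta_unity n : (0 < n)%N -> zeta n ^+ n = 1.
Proof. by move/zeta_prim/prim_expr_order. Qed.

Lemma zetaV_unity n : (0 < n)%N -> (zeta n)^-1 ^+ n = 1.
Proof. by move=> n_gt0; rewrite exprVn zeta_unity ?invr1. Qed.

(** Raising the level to a multiple lets any two elements be compared at a common one. *)
Lemma zeta_lift p n m : (0 < n)%N -> (0 < m)%N -> exists q,
  p^f.[zeta n] = q^f.[zeta (n * m)] /\ p^f.[(zeta n)^-1] = q^f.[(zeta (n * m))^-1].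
Proof.
move=> n_gt0 m_gt0; exists (p \Po 'X^m).
by rewrite !comp_Xn_horner exprVn zeta_exp.
Qed.

Lemma inv_rel_common x y x' y' : inv_rel x y -> inv_rel x' y' ->
  exists2 n, (0 < n)%N & exists p q,
    [/\ x = p^f.[zeta n], y = p^f.[(zeta n)^-1],
        x' = q^f.[zeta n] & y' = q^f.[(zeta n)^-1]].
Proof.
case=> n n_gt0 [p [-> ->]] [m m_gt0 [q [-> ->]]].
exists (n * m)%N; first by rewrite muln_gt0 n_gt0.
have [p' [-> ->]] := zeta_lift p n_gt0 m_gt0.
have [q' [-> ->]] := zeta_lift q m_gt0 n_gt0.
by exists p', q'; rewrite (mulnC n m).
Qed.

(** Single-valuedness is where the transfer to [algC] enters, through [horner_unity_root_inv]. *)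
Lemma inv_rel_fun x y y' : inv_rel x y -> inv_rel x y' -> y = y'.
Proof.
move=> xy xy'; have [n n_gt0 [p [q [Dx -> Dx' ->]]]] := inv_rel_common xy xy'.
apply: horner_unity_root_inv (zeta_unity n_gt0) _ => //.
by rewrite -Dx -Dx'.
Qed.

Lemma inv_rel1 : inv_rel 1 1.
Proof. by exists 1%N => //; exists 1; rewrite rmorph1 !hornerC. Qed.

Lemma inv_relD x y x' y' : inv_rel x y -> inv_rel x' y' ->
  inv_rel (x + x') (y + y').
Proof.
move=> xy /(inv_rel_common xy)[n n_gt0 [p [q [-> -> -> ->]]]].
by exists n => //; exists (p + q); rewrite rmorphD !hornerD.
Qed.

Lemma inv_relB x y x' y' : inv_rel x y -> inv_rel x' y' ->
  inv_rel (x - x') (y - y').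
Proof.
move=> xy /(inv_rel_common xy)[n n_gt0 [p [q [-> -> -> ->]]]].
by exists n => //; exists (p - q); rewrite rmorphB !hornerD !hornerN.
Qed.

Lemma inv_relM x y x' y' : inv_rel x y -> inv_rel x' y' ->
  inv_rel (x * x') (y * y').
Proof.
move=> xy /(inv_rel_common xy)[n n_gt0 [p [q [-> -> -> ->]]]].
by exists n => //; exists (p * q); rewrite rmorphM !hornerM.
Qed.

Lemma inv_rel_unity u : is_root_of_unity u -> inv_rel u u^-1.
Proof.
case=> n n_gt0 /unity_rootP un1; have := prim_rootP (zeta_prim n_gt0) un1.
case=> i ->; exists n => //; exists 'X^i.
by rewrite /= map_polyXn !hornerXn exprVn.
Qed.

(** As sigma0 is an involution, this yields both stability and surjectivity in [sigma0_exists]. *)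
Lemma inv_rel_sym x y : inv_rel x y -> inv_rel y x.
Proof.
case=> n n_gt0 [p [-> ->]]; exists n => //; exists (p \Po 'X^(n.-1)).
rewrite !comp_Xn_horner !(@unity_root_exp_pred _ n) ?invrK //.
  exact: zetaV_unity.
exact: zeta_unity.
Qed.

Lemma inv_rel_Qab x y : inv_rel x y -> Qab x.
Proof.
case=> n n_gt0 [p [-> _]]; apply: Qab_horner; exists n => //.
by apply/unity_rootP/zeta_unity.
Qed.

Lemma Qab_inv_rel x : Qab x -> exists y, inv_rel x y.
Proof.
elim=> {x} [u Uu||x y _ [x' xx'] _ [y' yy']|x y _ [x' xx'] _ [y' yy']|x _ [x']].
- by exists u^-1; apply: inv_rel_unity.
- by exists 1; apply: inv_rel1.
- by exists (x' - y'); apply: inv_relB.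
- by exists (x' * y'); apply: inv_relM.
(* It suffices to write the inverse as a polynomial in [zeta n]; the value of that polynomial at the
   inverse root is then its partner. *)
case=> n n_gt0 [p [-> _]].
have [q ->] := horner_unity_rootV f p n_gt0 (zeta_unity n_gt0).
by exists q^f.[(zeta n)^-1], n => //; exists q.
Qed.

Lemma sigma0_exists :
  exists2 s : F -> F, is_sigma0 s & forall x y, inv_rel x y -> s x = y.
Proof.
(* The relation becomes a total function, with unspecified values outside [Qab]. *)
pose s x := epsilon (inhabits 0) (inv_rel x).
have sE x y : inv_rel x y -> s x = y.
  by move=> xy; apply: (inv_rel_fun _ xy); apply: epsilon_spec; exists y.
have sP x : Qab x -> inv_rel x (s x).
  by case/Qab_inv_rel=> y xy; rewrite (sE _ _ xy).
exists s => //; split=> [|u /inv_rel_unity/sE//]; split.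
- by move=> x /sP/inv_rel_sym/inv_rel_Qab.
- move=> y /Qab_inv_rel[x /inv_rel_sym xy].
  by exists x; [apply: inv_rel_Qab xy | apply: sE].
- exact/sE/inv_rel1.
- by move=> x y /sP xx' /sP yy'; apply/sE/inv_relD.
- by move=> x y /sP xx' /sP yy'; apply/sE/inv_relM.
Qed.

(** [Qrab] quantifies over all candidates for sigma0, so its condition says something about [x] only
    once one has been built. *)
Lemma Qrab_horner x : Qrab x -> exists2 n, (0 < n)%N & exists p,
  x = p^f.[zeta n] /\ x = p^f.[(zeta n)^-1].
Proof.
case=> /Qab_inv_rel[y xy] fix_x; have [s sigma_s sE] := sigma0_exists.
have Dy : y = x by rewrite -(sE _ _ xy) fix_x.
by rewrite Dy in xy.
Qed.

End InverseAutomorphism.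

(** * The kernel and its generators *)

(** A first-order substitute for being a generator: it quantifies over elements of [F] only, never
    over integers. *)
Definition kernel_generating (F : fieldType) (E : F -> F) (t : F) : Prop :=
  [/\ E t = 1, t <> 0 &
    forall m, E (m * t) = 1 -> forall y, E y = 1 -> E (m * y) = 1].

Section CyclicKernel.

Variables (F : fieldType) (E : F -> F) (tau : F).
Hypothesis expE : exponential_field E.
Hypothesis tau_inj : injective (fun m : int => tau *~ m).
Hypothesis kerP : forall x, E x = 1 <-> exists m : int, x = tau *~ m.

Let pcharF0 : [pchar F] =i pred0 := expfield_pchar0 expE.

Lemma expfield_EMn x n : E (x *+ n) = E x ^+ n.
Proof.
elim: n => [|n IHn]; first by rewrite mulr0n expfield_E0.
by rewrite mulrS exprS (expfield_ED expE) IHn.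
Qed.

Lemma kernel_gen_neq0 : tau != 0.
Proof.
apply/eqP=> tau0; have /tau_inj// : tau *~ 0 = tau *~ 1.
by rewrite tau0 !mul0rz.
Qed.

Lemma kernel_mulr_genP x : E (x * tau) = 1 <-> exists m : int, x = m%:~R.
Proof.
rewrite kerP; split=> -[m Dx]; exists m; last by rewrite Dx mulrzl.
by apply: (mulIf kernel_gen_neq0); rewrite Dx mulrzl.
Qed.

Lemma kernel_zeta_prim n : (0 < n)%N -> n.-primitive_root (E (tau / n%:R)).
Proof.
move=> n_gt0; have nz_n : n%:R != 0 :> F by rewrite (pcharf0P F).1 // -lt0n.
have zeta_n1 : E (tau / n%:R) ^+ n = 1.
  rewrite -expfield_EMn -(mulr_natr (_ / _)) divfK //.
  by apply/kerP; exists 1; rewrite mulr1z.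
(* The boolean definition asks, for [i < n], that the power [i.+1] be 1 exactly when [i.+1 = n]. *)
rewrite /primitive_root_of_unity n_gt0; apply/forallP=> i; apply/eqP.
rewrite unity_rootE; apply/eqP/eqP=> [zeta_i1 | ->//].
apply/eqP; rewrite eqn_leq ltn_ord dvdn_leq //.
move: zeta_i1; rewrite -expfield_EMn -(mulr_natr (_ / _)) mulrAC -mulrA mulrC.
(* The quotient of [i.+1] by [n] is an integer [m] in [F]; characteristic 0 brings the equation back
   to [int]. *)
case/kernel_mulr_genP=> m /(canRL (divfK nz_n)) Di.
suff : (n%:Z %| i.+1%:Z)%Z by []; apply/dvdzP.
exists m; apply/eqP; rewrite -subr_eq0 -(pchar0_intr_eq0 pcharF0).
by rewrite intrB intrM subr_eq0; apply/eqP.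
Qed.

Lemma kernel_zeta_exp n m : (0 < n)%N -> (0 < m)%N ->
  E (tau / (n * m)%N%:R) ^+ m = E (tau / n%:R).
Proof.
move=> n_gt0 m_gt0; rewrite -expfield_EMn -(mulr_natr (_ / _)) natrM invfM mulrA divfK //.
by rewrite (pcharf0P F).1 // -lt0n.
Qed.

(* For t = k tau the closure condition, applied to m = 1/k, makes 1/k an
   integer. *)
Lemma kernel_generatorP t :
  kernel_generating E t <-> t = tau \/ t = - tau.
Proof.
split=> [[/kerP[k Dt] nz_t stab_t] | Dt].
  have nz_k : k%:~R != 0 :> F.
    by apply/eqP=> k0; apply: nz_t; rewrite Dt -mulrzl k0 mul0r.
  have E_tau : E tau = 1 by apply/kerP; exists 1; rewrite mulr1z.
  have /stab_t/(_ _ E_tau) : E (k%:~R^-1 * t) = 1.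
    by rewrite Dt -(mulrzl tau) mulKf.
  case/kernel_mulr_genP=> j Dj.
  have /eqP : k * j - 1 == 0.
    by rewrite -(pchar0_intr_eq0 pcharF0) intrB intrM -Dj mulfV // subrr.
  move/eqP; rewrite subr_eq0 => /eqP kj1.
  have : k \is a GRing.unit by apply/unitrP; exists j; rewrite mulrC.
  rewrite Dt; case/pred2P=> ->; [left | right]; first by rewrite mulr1z.
  by rewrite mulrN1z.
(* A sign [e] with square 1 treats both generators in one computation. *)
have [e De] : exists e : int, t = e%:~R * tau /\ e * e = 1.
  case: Dt => ->; [exists 1 | exists (-1)]; split=> //.
    by rewrite mulr1z mul1r.
  by rewrite mulrN1z mulN1r.
have tE m : m * t = (m * e%:~R) * tau by rewrite De.1 mulrA.
split=> [||m].
- by rewrite De.1; apply/kernel_mulr_genP; exists e.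
- by case: Dt => ->; apply/eqP; rewrite ?oppr_eq0 kernel_gen_neq0.
rewrite tE => /kernel_mulr_genP[j Dj] y /kerP[i ->].
rewrite -mulrzl mulrA; apply/kernel_mulr_genP; exists (j * e * i).
by rewrite !intrM -Dj -(mulrA m) -[e%:~R * e%:~R]intrM De.2 mulr1.
Qed.

End CyclicKernel.

(** * Terms and formulas *)

Fixpoint nat_eterm n (k : nat) : eterm n :=
  if k is k'.+1 then EAdd (EOne n) (nat_eterm n k') else EZero n.

Definition int_eterm n (m : int) : eterm n :=
  match m with
  | Posz k => nat_eterm n k
  | Negz k => EOpp (nat_eterm n k.+1)
  end.

(** Coefficients run from the constant one upwards, as in [polyseq]; they are integers because the
    language has no division. *)
Definition horner_eterm n (s : seq int) (t : eterm n) : eterm n :=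
  foldr (fun c u => EAdd (EMul u t) (int_eterm n c)) (EZero n) s.

Section TermEvaluation.

Variables (F : fieldType) (E : F -> F) (n : nat) (e : 'I_n -> F).

Lemma eval_nat_eterm k : eval_eterm E e (nat_eterm n k) = k%:R.
Proof. by elim: k => //= k ->; rewrite mulrS. Qed.

Lemma eval_int_eterm m : eval_eterm E e (int_eterm n m) = m%:~R.
Proof. by case: m => k; rewrite /= eval_nat_eterm // NegzE mulrNz -pmulrn mulrS. Qed.

Lemma eval_horner_eterm (q : {poly int}) t :
  eval_eterm E e (horner_eterm q t) = (map_poly intr q).[eval_eterm E e t].
Proof.
rewrite map_polyE horner_Poly; elim: (polyseq q) => //= c s ->.
by rewrite eval_int_eterm.
Qed.

Lemma env_cons0 x : env_cons x e ord0 = x.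
Proof. by rewrite /env_cons unlift_none. Qed.

Lemma env_consS x i : env_cons x e (lift ord0 i) = e i.
Proof. by rewrite /env_cons liftK. Qed.

End TermEvaluation.

Notation evar0 := (EVar ord0).
Notation evar1 := (EVar (lift ord0 ord0)).
Notation evar2 := (EVar (lift ord0 (lift ord0 ord0))).

Definition ker_formula n (t : eterm n) : eformula n := FEq (EExp t) (EOne n).

(** The candidate is [evar0], then [evar1] under the first quantifier; the multiplier bound there
    becomes [evar1] under the second. *)
Definition generator_formula n : eformula n.+1 :=
  FAnd (ker_formula evar0) (FAnd (FNot (FEq evar0 (EZero _)))
    (FForall (FImp (ker_formula (EMul evar0 evar1))
       (FForall (FImp (ker_formula evar0) (ker_formula (EMul evar1 evar0))))))).

Lemma sat_generator_formula (F : fieldType) (E : F -> F) n (e : 'I_n -> F) t :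
  esat E (generator_formula n) (env_cons t e) <->
  kernel_generating E t.
Proof.
split=> /= [[Et [nz_t stab_t]] | [Et nz_t stab_t]].
  rewrite env_cons0 in Et nz_t; split=> // m Emt y Ey.
  have := stab_t m; rewrite env_consS !env_cons0 => /(_ Emt y).
  by rewrite env_consS !env_cons0; apply.
rewrite env_cons0; do 2?split=> //.
move=> m; rewrite env_consS !env_cons0 => Emt y.
by rewrite env_consS !env_cons0; apply: stab_t.
Qed.

(** Innermost, [evar2] is the element to define, [evar1] a generator and [evar0] its quotient by
    [N]; the divisions by [N] and [d] are written as multiplications. *)
Definition real_abelian_formula N (d : int) (q : {poly int}) : eformula 1 :=
  FExists (FAnd (generator_formula 1)
    (FExists (FAnd (FEq (EMul (nat_eterm 3 N) evar0) evar1)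
       (FEq (EMul (int_eterm 3 d) evar2) (horner_eterm q (EExp evar0)))))).

Lemma sat_real_abelian_formula (F : fieldType) (E : F -> F) N d q (x : F) :
  esat E (real_abelian_formula N d q) (fun=> x) <->
  exists2 t, kernel_generating E t &
    exists2 s, N%:R * s = t & d%:~R * x = (map_poly intr q).[E s].
Proof.
rewrite /real_abelian_formula; split=> [[t [/sat_generator_formula gen_t [s []]]] |].
  rewrite /= eval_nat_eterm eval_int_eterm eval_horner_eterm /=.
  by rewrite !env_consS !env_cons0; exists t => //; exists s.
case=> t /sat_generator_formula gen_t [s Ds Dx].
exists t; split; first exact: gen_t.
exists s; rewrite /= eval_nat_eterm eval_int_eterm eval_horner_eterm /=.
by rewrite !env_consS !env_cons0.
Qed.

Theorem theorem1 (F : fieldType) (E : F -> F)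
    (expE : exponential_field E) (kerE : infinite_cyclic (exp_kernel E))
    (alpha : F) (Halpha : Qrab alpha) :
  pointwise_definable E alpha.
Proof.
have pcharF0 := expfield_pchar0 expE.
case: kerE => tau [tau_inj kerP].
have [f _] := pchar0_rmorph_rat pcharF0.
have [N N_gt0 [p [Dalpha DalphaV]]] := Qrab_horner f
  (kernel_zeta_prim expE tau_inj kerP) (kernel_zeta_exp tau expE) Halpha.
(* Denominators are cleared: [p] is the integral polynomial [q] divided by [d]. *)
have [q [d nz_d Dp]] := rat_poly_scale p.
have nz_N : N%:R != 0 :> F by rewrite (pcharf0P F).1 // -lt0n.
have nz_dF : d%:~R != 0 :> F by rewrite pchar0_intr_eq0.
have pE z : d%:~R * (map_poly f p).[z] = (map_poly intr q).[z].
  rewrite Dp map_polyZ hornerZ fmorphV rmorph_int mulVKf //.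
  rewrite -map_poly_comp; congr _.[z]; apply: eq_map_poly => a /=.
  exact: rmorph_int.
have EN x : E (- x) = (E x)^-1.
  by apply/esym/mulr1_eq; rewrite -(expfield_ED expE) subrr (expfield_E0 expE).
exists (real_abelian_formula N d q) => x; rewrite sat_real_abelian_formula.
split=> [[t /(kernel_generatorP expE tau_inj kerP) Dt [s Ds /esym]] | ->].
  rewrite -pE => /(mulfI nz_dF) <-.
  have -> : s = t / N%:R by rewrite -Ds mulrC mulKf.
  (* The two generators give mutually inverse roots of unity, and [p] takes the value [alpha] at
     both. *)
  by case: Dt => ->; rewrite ?mulNr ?EN.
exists tau; first by apply/(kernel_generatorP expE tau_inj kerP); left.
exists (tau / N%:R); first by rewrite mulrC divfK.
by rewrite -pE -Dalpha.
Qed.
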